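(* Let $\mathbb{F}_q$ be a finite field, let $r,s\ge 1$ be integers with $r\le q$, let $\alpha_1,\ldots,\alpha_r\in\mathbb{F}_q$ be pairwise distinct, $\mathcal{A}=\{\alpha_1,\ldots,\alpha_r\}$, let $V=(v_{i,j})\in(\mathbb{F}_q^\ast)^{s\times r}$, and let $0\le k\le rs$. Let $C=\operatorname{HRS}_k(\mathcal{A},V,s,r)$. For $1\le j\le r$ put $A_j(x)=\prod_{\ell\ne j}(x-\alpha_\ell)^s$ and, for $0\le i\le s-1$, $\gamma_{i,j}=\partial^{(i)}\!\left(\frac{1}{A_j(x)}\right)\big|_{x=\alpha_j}$. For $g\in\mathcal{P}_{<rs-k}$ let \[ w_{i,j}(g)=\frac{1}{v_{i,j}}\,\partial^{(s-i)}\!\left(\frac{g(x)}{A_j(x)}\right)\bigg|_{x=\alpha_j},\qquad 1\le i\le s,\ 1\le j\le r, \] so that $C^\perp=\{(w_{i,j}(g))_{i,j}: g\in\mathcal{P}_{<rs-k}\}$. For each $j$ let $\mathbf{w}_j(g)=(w_{1,j}(g),\ldots,w_{s,j}(g))^\top$ and let $\mathbf{d}_j(g)=(\partial^{(s-1)}g(\alpha_j),\partial^{(s-2)}g(\alpha_j),\ldots,\partial^{(0)}g(\alpha_j))^\top$. Let $D_j=\operatorname{diag}(v_{1,j}^{-1},\ldots,v_{s,j}^{-1})$, and let $U_j$ be the $s\times s$ upper triangular Toeplitz matrix whose $(a,b)$ entry is $\gamma_{b-a,j}$ if $b\ge a$ and $0$ if $b<a$. Then: (1) for all $g\in\mathcal{P}_{<rs-k}$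 and all $1\le j\le r$, $\mathbf{w}_j(g)=D_jU_j\mathbf{d}_j(g)$; (2) $\gamma_{0,j}=1/A_j(\alpha_j)\neq0$, and hence $U_j$ is invertible, for all $1\le j\le r$. (3) In general $C^\perp$ is not necessarily an HRS code: there exist a finite field $\mathbb{F}_q$, integers $r,s\ge 1$ with $r\le q$, an integer $k$ with $0\le k\le rs$, a set $\mathcal{A}=\{\alpha_1,\ldots,\alpha_r\}$ of $r$ pairwise distinct elements of $\mathbb{F}_q$, and a multiplier matrix $V\in(\mathbb{F}_q^\ast)^{s\times r}$ such that $\operatorname{HRS}_k(\mathcal{A},V,s,r)^\perp\ne\operatorname{HRS}_{rs-k}(\mathcal{B},U,s,r)$ for every choice of pairwise distinct evaluation points $\mathcal{B}=\{\beta_1,\ldots,\beta_r\}\subseteq\mathbb{F}_q$ and every multiplier matrix $U\in(\mathbb{F}_q^\ast)^{s\times r}$.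
   Context: For an integer $h\ge 0$, $\mathcal{P}_{<h}=\{f\in\mathbb{F}_q[x]:\deg f<h\}$, with $\mathcal{P}_{<0}=\{0\}$. Hasse derivative (hyperderivative): for $f(x)=\sum_\ell f_\ell x^\ell\in\mathbb{F}_q[x]$ and $j\ge0$, $\partial^{(j)}f(x)=\sum_{\ell}\binom{\ell}{j}f_\ell x^{\ell-j}$ (with $\binom{\ell}{j}=0$ if $j>\ell$, binomials reduced modulo the characteristic). For a rational function $\phi\in\mathbb{F}_q(x)$ regular at $u\in\mathbb{F}_q$, $\partial^{(j)}\phi(x)|_{x=u}$ denotes the coefficient of $(x-u)^j$ in the power series expansion of $\phi$ at $u$. Hyperderivative Reed–Solomon (HRS) code: for $0\le k\le rs$, \[ \operatorname{HRS}_k(\mathcal{A},V,s,r)=\left\{\bigl(v_{i,j}\,\partial^{(i-1)}f(\alpha_j)\bigr)_{1\le i\le s,\,1\le j\le r}: f\in\mathcal{P}_{<k}\right\}\subseteq\operatorname{Mat}_{s\times r}(\mathbb{F}_q). \] Euclidean inner product on $\operatorname{Mat}_{s\times r}(\mathbb{F}_q)$: $\langle A,B\rangle=\sum_{i,j}a_{i,j}b_{i,j}$; the Euclidean dual of a linear code $C$ is $C^\perp=\{B:\langle A,B\rangle=0\text{ for all }A\in C\}$. *)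

(* Defs.v *)
From HB Require Import structures.
From mathcomp Require Import all_boot all_order all_algebra.
From mathcomp Require Import generic_quotient fraction.

Set Implicit Arguments.
Unset Strict Implicit.
Unset Printing Implicit Defensive.

Import GRing.Theory.
Local Open Scope ring_scope.
Local Open Scope quotient_scope.

(* fraction.v does not export this notation for its embedding.                *)
Notation "x %:F" := (@FracField.tofrac _ x) : ring_scope.

(* The Hasse derivative of a polynomial is p^`N(j):                           *)
(*   coef_nderivn : p^`N(j)`_i = p`_(j + i) *+ 'C(j + i, j).                  *)
(* P_{<h} is {poly_h F}, the type of p with size p <= h.                      *)

(* A power series in t = 'X - u is given by its sequence of coefficients.     *)
Section PowerSeries.
Variable F : fieldType.
Implicit Types (a b c : nat -> F) (p d : {poly F}) (u : F).

Definition ser_mul a b (n : nat) : F := \sum_(i < n.+1) a i * b (n - i)%N.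

(* The first n.+1 coefficients of 1 / a, for a with a 0 != 0, from the        *)
(* recursion c 0 = 1 / a 0 and                                                *)
(*   c n.+1 = - (1 / a 0) * \sum_(i <= n) a i.+1 * c (n - i).                 *)
Fixpoint ser_inv_seq a (n : nat) : seq F :=
  if n is m.+1 then
    let c := ser_inv_seq a m in
    rcons c (- (a 0%N)^-1 * \sum_(i < m.+1) a i.+1 * c`_(m - i))
  else [:: (a 0%N)^-1].

Definition ser_inv a (n : nat) : F := (ser_inv_seq a n)`_n.

Definition poly_ser p u (n : nat) : F := (p \Po ('X + u%:P))`_n.

(* Numerator and denominator of a rational function in lowest terms, so that  *)
(* phi is regular at u iff (rat_den phi).[u] != 0.                            *)
Definition rat_num (phi : {fraction {poly F}}) : {poly F} :=
  (frac (repr phi)).1 %/ gcdp (frac (repr phi)).1 (frac (repr phi)).2.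

Definition rat_den (phi : {fraction {poly F}}) : {poly F} :=
  (frac (repr phi)).2 %/ gcdp (frac (repr phi)).1 (frac (repr phi)).2.

(* The coefficient of ('X - u)^j in the expansion of phi at u; meaningful     *)
(* when phi is regular at u, see rat_hderivP.                                 *)
Definition rat_hderiv (j : nat) (phi : {fraction {poly F}}) (u : F) : F :=
  ser_mul (poly_ser (rat_num phi) u) (ser_inv (poly_ser (rat_den phi) u)) j.

Lemma ser_mulE a b N n : (n < N)%N ->
  ser_mul a b n = (\poly_(i < N) a i * \poly_(i < N) b i)`_n.
Proof.
move=> ltnN; rewrite coefM; apply: eq_bigr => i _.
by rewrite !coef_poly (leq_ltn_trans (leq_subr _ _) ltnN)
           (leq_ltn_trans _ ltnN) // -ltnS.
Qed.

Lemma ser_mulC a b : ser_mul a b =1 ser_mul b a.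
Proof. by move=> n; rewrite !(ser_mulE _ _ (ltnSn n)) mulrC. Qed.

Lemma eq_ser_mul a a' b b' :
  a =1 a' -> b =1 b' -> ser_mul a b =1 ser_mul a' b'.
Proof. by move=> ea eb n; apply: eq_bigr => i _; rewrite ea eb. Qed.

Lemma ser_mulA a b c : ser_mul a (ser_mul b c) =1 ser_mul (ser_mul a b) c.
Proof.
move=> n; pose t (x : nat -> F) := \poly_(i < n.+1) x i.
transitivity (t a * (t b * t c))`_n.
  rewrite coefM; apply: eq_bigr => i _.
  by rewrite coef_poly ltn_ord -ser_mulE // ltnS leq_subr.
rewrite mulrA coefM; apply: eq_bigr => i _.
by rewrite [(t c)`_ _]coef_poly ltnS leq_subr -ser_mulE.
Qed.

Lemma ser_mul1 a : ser_mul (fun n => (n == 0)%:R) a =1 a.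
Proof.
move=> n; rewrite /ser_mul big_ord_recl subn0 mul1r big1 ?addr0 // => i _.
by rewrite mul0r.
Qed.

Lemma size_ser_inv_seq a n : size (ser_inv_seq a n) = n.+1.
Proof. by elim: n => //= n IHn; rewrite size_rcons IHn. Qed.

Lemma nth_ser_inv_seq a n i : (i <= n)%N -> (ser_inv_seq a n)`_i = ser_inv a i.
Proof.
elim: n => [|n IHn]; first by rewrite leqn0 => /eqP ->.
rewrite leq_eqVlt => /orP[/eqP-> //|lein].
by rewrite /= nth_rcons size_ser_inv_seq lein IHn.
Qed.

Lemma ser_mulV a : a 0%N != 0 ->
  ser_mul a (ser_inv a) =1 (fun n => (n == 0)%:R).
Proof.
move=> a0 [|n]; rewrite /ser_mul.
  by rewrite big_ord_recl big_ord0 addr0 /ser_inv /= mulfV.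
rewrite big_ord_recl subn0 {1}/ser_inv /= nth_rcons size_ser_inv_seq ltnn eqxx.
rewrite mulrA mulrN mulfV // mulN1r; apply/eqP; rewrite addrC subr_eq0; apply/eqP.
by apply: eq_bigr => i _; rewrite subSS nth_ser_inv_seq // leq_subr.
Qed.

Lemma poly_serM p d u :
  poly_ser (p * d) u =1 ser_mul (poly_ser p u) (poly_ser d u).
Proof. by move=> n; rewrite /poly_ser comp_polyM coefM. Qed.

Lemma poly_ser_0 p u : poly_ser p u 0%N = p.[u].
Proof.
by rewrite /poly_ser -horner_coef0 horner_comp hornerD hornerX hornerC add0r.
Qed.

Lemma poly_ser_hderiv p u n : poly_ser p u n = p^`N(n).[u].
Proof.
rewrite /poly_ser.
rewrite comp_polyE (eq_bigr (fun i : 'I_(size p) => 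
    p`_i *: \sum_(l < i.+1) (u ^+ (i - l) *+ 'C(i, l)) *: 'X^l)); last first.
  move=> i _; congr (_ *: _); rewrite addrC exprDn; apply: eq_bigr => l _.
  by rewrite -polyC_exp mul_polyC scalerMnl.
rewrite coef_sum (@horner_coef_wide _ (size p)); last first.
  by rewrite (leq_trans (size_poly _ _)) ?leq_subr.
have E (i : 'I_(size p)) : (p`_i *: \sum_(l < i.+1)
    (u ^+ (i - l) *+ 'C(i, l)) *: 'X^l)`_n = p`_i * (u ^+ (i - n) *+ 'C(i, n)).
  rewrite coefZ coef_sum; congr (_ * _).
  have [lt|ge] := ltnP n i.+1.
    rewrite (bigD1 (Ordinal lt)) //= big1 ?addr0 => [|l neq].
      by rewrite coefZ coefXn eqxx mulr1.
    rewrite coefZ coefXn; case: eqP => [e|_]; last by rewrite mulr0.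
    by case/eqP: neq; apply: val_inj.
  rewrite bin_small // mulr0n big1 // => l _.
  rewrite coefZ coefXn; case: eqP => [e|_]; last by rewrite mulr0.
  by move: (ltn_ord l); rewrite -e ltnNge ge.
rewrite (eq_bigr _ (fun i _ => E i)).
pose g i := p`_i * (u ^+ (i - n) *+ 'C(i, n)).
rewrite -(big_mkord xpredT g) -(big_mkord xpredT (fun i => p^`N(n)`_i * u ^+ i)).
transitivity (\sum_(0 <= i < n + size p) g i).
  rewrite [RHS](@big_cat_nat _ _ _ (size p)) ?leq_addl //=.
  rewrite [X in _ + X]big_nat_cond [X in _ + X]big1 ?addr0 // => i.
  by rewrite andbT => /andP[le _]; rewrite /g nth_default // mul0r.
rewrite (@big_cat_nat _ _ _ n) ?leq_addr //=.
rewrite [X in X + _]big_nat_cond [X in X + _]big1 ?add0r => [|i]; last first.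
  by rewrite andbT => /andP[_ lt]; rewrite /g bin_small // mulr0n mulr0.
rewrite -{1}[n]add0n big_addn addKn; apply: eq_bigr => i _.
by rewrite /g coef_nderivn addnK addnC mulrnAr mulrnAl.
Qed.

Lemma rat_hderivP (p d : {poly F}) u : d.[u] != 0 ->
  ser_mul (poly_ser d u)
    (fun j => rat_hderiv j (p%:F / d%:F : {fraction {poly F}}) u)
    =1 poly_ser p u.
Proof.
move=> du; set phi := _ / _.
have d0 : d != 0 by apply: contraNneq du => ->; rewrite horner0.
set a := (frac (repr phi)).1; set b := (frac (repr phi)).2.
have b0 : b != 0 by exact: denom_ratioP.
have Ephi : phi = a%:F / b%:F.
  rewrite -[LHS]reprK -[repr phi in LHS]Ratio_numden -/a -/b.
  apply: (mulIf (_ : b%:F != 0)); rewrite ?tofrac_eq0 // divfK ?tofrac_eq0 //.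
  unlock FracField.tofrac; rewrite -[LHS]FracField.pi_mul.
  apply/eqmodP; rewrite /= FracField.equivfE /FracField.mulf.
  by rewrite !numden_Ratio ?mulf_neq0 ?oner_eq0 // !mulr1 mulrC.
have Eab : p * b = a * d.
  apply/eqP; rewrite -tofrac_eq !tofracM.
  by rewrite -(eqr_div _ _ (_ : d%:F != 0)) ?tofrac_eq0 // -Ephi.
set g := gcdp a b.
have g0 : g != 0 by rewrite gcdp_eq0 negb_and b0 orbT.
have Ea : a = rat_num phi * g by rewrite divpK // dvdp_gcdl.
have Eb : b = rat_den phi * g by rewrite divpK // dvdp_gcdr.
have cop : coprimep (rat_num phi) (rat_den phi).
  by apply: coprimep_div_gcd; rewrite b0 orbT.
have E : p * rat_den phi = rat_num phi * d.
  by apply: (mulIf g0); rewrite -mulrA -Eb Eab Ea mulrAC.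
have bu : (rat_den phi).[u] != 0.
  apply/negP => bu0.
  have /eqP au0 : (rat_num phi).[u] == 0.
    have := congr1 (horner^~ u) E; rewrite !hornerM (eqP bu0) mulr0.
    by move/esym/eqP; rewrite mulf_eq0 (negPf du) orbF.
  by have := coprimep_root cop (introT eqP au0); rewrite bu0.
move=> n; rewrite /rat_hderiv ser_mulA.
rewrite (eq_ser_mul (ser_mulC _ _) (frefl _)) //.
rewrite (eq_ser_mul (fun m => esym (poly_serM _ _ _ m)) (frefl _)) -E.
rewrite (eq_ser_mul (poly_serM _ _ _) (frefl _)) -ser_mulA ser_mulC.
rewrite (eq_ser_mul (ser_mulV _) (frefl _)) ?poly_ser_0 //.
exact: ser_mul1.
Qed.

End PowerSeries.

(* Indices are 0-based: the entry (i, j) below is the (i+1, j+1) entry of the *)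
(* usual 1-based notation; thus order i - 1 becomes i and s - i becomes       *)
(* s - i.+1.                                                                  *)
Section HRS.
Variables (F : finFieldType) (s r : nat).
Implicit Types (alpha : 'I_r -> F) (V : 'M[F]_(s, r)).

Definition hrs_word alpha V (f : {poly F}) : 'M[F]_(s, r) :=
  \matrix_(i, j) (V i j * f^`N(i).[alpha j]).

Definition HRS (k : nat) alpha V : {set 'M[F]_(s, r)} :=
  [set hrs_word alpha V f | f : {poly_k F}].

Definition mx_dot (A B : 'M[F]_(s, r)) : F := \sum_i \sum_j A i j * B i j.

Definition euclidean_dual (C : {set 'M[F]_(s, r)}) : {set 'M[F]_(s, r)} :=
  [set B | [forall A in C, mx_dot A B == 0]].

Definition Apoly alpha (j : 'I_r) : {poly F} :=
  \prod_(l < r | l != j) ('X - (alpha l)%:P) ^+ s.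

Definition hrs_gamma alpha (i : nat) (j : 'I_r) : F :=
  rat_hderiv i ((Apoly alpha j)%:F)^-1 (alpha j).

Definition dual_word alpha V (g : {poly F}) : 'M[F]_(s, r) :=
  \matrix_(i, j)
    ((V i j)^-1 * rat_hderiv (s - i.+1) (g%:F / (Apoly alpha j)%:F) (alpha j)).

Definition hderiv_vec alpha (j : 'I_r) (g : {poly F}) : 'cV[F]_s :=
  \col_i g^`N(s - i.+1).[alpha j].

Definition diagD V (j : 'I_r) : 'M[F]_s := diag_mx (\row_i (V i j)^-1).

Definition toeplitzU alpha (j : 'I_r) : 'M[F]_s :=
  \matrix_(a, b) (if (a <= b)%N then hrs_gamma alpha (b - a)%N j else 0).

End HRS.

(* Main.v *)
(* For A_j = \prod_(l != j) (x - alpha_l)^s, a polynomial p of degree < r s is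
   determined by the expansions of p / A_j at alpha_j up to order s - 1: indeed
   p = \sum_j q_j A_j where q_j is the truncation of p / A_j.  Comparing the
   coefficients of x^(r s - 1), the sum over j of the coefficients of order
   s - 1 is that of x^(r s - 1) in p.  Applied to p = f g this computes the
   pairing of the word of f with the dual word of g; every matrix is a dual
   word of some g of degree < r s, and pairing with a power of x shows that
   deg g < r s - k when it is orthogonal to the code. *)
Require Import Defs.
From mathcomp Require Import all_boot all_order all_algebra.
From mathcomp Require Import zify.
Import GRing.Theory.
Local Open Scope ring_scope.

Set Implicit Arguments.
Unset Strict Implicit.
Unset Printing Implicit Defensive.

(** * Expansions of quotients of polynomials at a point *)

Section QuotientSeries.
Variable F : fieldType.
Implicit Types (p q d f : {poly F}) (u : F).

(** The expansion of p / d at u when [d.[u] != 0], taken from p and d themselves and not from lowest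
    terms, so that it is visibly linear in p. *)
Definition quot_ser d p u : nat -> F :=
  ser_mul (ser_inv (poly_ser d u)) (poly_ser p u).

Lemma rat_hderivE p d u j : d.[u] != 0 ->
  rat_hderiv j (p%:F / d%:F) u = quot_ser d p u j.
Proof.
move=> du; rewrite /quot_ser.
rewrite -(eq_ser_mul (frefl _) (rat_hderivP p du)) ser_mulA.
rewrite (eq_ser_mul (ser_mulC _ _) (frefl _)).
rewrite (eq_ser_mul (ser_mulV _) (frefl _)) ?poly_ser_0 //.
by rewrite ser_mul1.
Qed.

Lemma rat_hderivV d u j : d.[u] != 0 ->
  rat_hderiv j (d%:F)^-1 u = ser_inv (poly_ser d u) j.
Proof.
move=> du; rewrite -[(_)^-1]mul1r -tofrac1 rat_hderivE // /quot_ser ser_mulC.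
rewrite -[RHS]ser_mul1; apply: eq_ser_mul => // n.
by rewrite /poly_ser comp_polyC coef1.
Qed.

Lemma quot_serM f d p u :
  quot_ser d (f * p) u =1 ser_mul (poly_ser f u) (quot_ser d p u).
Proof.
move=> n; rewrite /quot_ser ser_mulA.
rewrite (eq_ser_mul (ser_mulC _ _) (frefl _)) -ser_mulA.
by apply: eq_ser_mul => // m; rewrite poly_serM.
Qed.

Lemma quot_ser_id d p u : d.[u] != 0 -> quot_ser d (p * d) u =1 poly_ser p u.
Proof.
move=> du n; rewrite quot_serM /quot_ser ser_mulC -[RHS]ser_mul1.
apply: eq_ser_mul => // m.
by rewrite ser_mulC ser_mulV // poly_ser_0.
Qed.

Lemma quot_serB d p q u n :
  quot_ser d (p - q) u n = quot_ser d p u n - quot_ser d q u n.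
Proof.
rewrite /quot_ser /ser_mul -sumrB; apply: eq_bigr => i _.
by rewrite -mulrBr /poly_ser comp_polyB coefB.
Qed.

Lemma quot_ser_sum (I : finType) (P : pred I) (f : I -> {poly F}) d u n :
  quot_ser d (\sum_(l | P l) f l) u n = \sum_(l | P l) quot_ser d (f l) u n.
Proof.
rewrite /quot_ser /ser_mul exchange_big /=; apply: eq_bigr => i _.
by rewrite -mulr_sumr /poly_ser linear_sum /= coef_sum.
Qed.

Lemma comp_XsubC_addC u : ('X - u%:P) \Po ('X + u%:P) = 'X.
Proof. by rewrite comp_polyB comp_polyX comp_polyC addrK. Qed.

Lemma comp_XaddC_subC u : ('X + u%:P) \Po ('X - u%:P) = 'X.
Proof. by rewrite comp_polyD comp_polyX comp_polyC subrK. Qed.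

(** Translation by u turns divisibility by a power of X - u into vanishing of low coefficients. *)
Lemma dvd_XsubC_expP p u s :
  reflect (forall n, (n < s)%N -> poly_ser p u n = 0) (('X - u%:P) ^+ s %| p).
Proof.
apply: (iffP idP) => [/dvdpP[q ->] n ltns|H].
  by rewrite /poly_ser comp_polyM rmorphXn /= comp_XsubC_addC coefMXn ltns.
have -> : p = (p \Po ('X + u%:P)) \Po ('X - u%:P).
  by rewrite -comp_polyA comp_XaddC_subC comp_polyXr.
rewrite -(poly_take_drop s (p \Po _)).
have -> : take_poly s (p \Po ('X + u%:P)) = 0.
  by apply/polyP=> n; rewrite coef_take_poly coef0; case: ifP => // /H.
by rewrite add0r comp_polyM rmorphXn /= comp_polyX dvdp_mulIr.
Qed.

Lemma quot_ser_eq0 d p u s :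
  (forall n, (n < s)%N -> poly_ser p u n = 0) ->
  forall n, (n < s)%N -> quot_ser d p u n = 0.
Proof.
move=> H n ltns; rewrite /quot_ser /ser_mul big1 // => i _.
by rewrite H ?mulr0 // (leq_ltn_trans (leq_subr _ _)).
Qed.

(** Multiplying p / d back by d, the first s coefficients of p involve only the first s of p / d. *)
Lemma quot_ser_eq0_dvd d p u s : d.[u] != 0 ->
  (forall n, (n < s)%N -> quot_ser d p u n = 0) -> ('X - u%:P) ^+ s %| p.
Proof.
move=> du H; apply/dvd_XsubC_expP => n ltns.
rewrite -(quot_ser_id p du) [p * d]mulrC quot_serM /ser_mul big1 // => i _.
by rewrite H ?mulr0 // (leq_ltn_trans (leq_subr _ _)).
Qed.

Lemma coef_comp_XsubC p u s : (size p <= s)%N ->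
  (p \Po ('X - u%:P))`_s.-1 = p`_s.-1.
Proof.
move=> ps; have sX := size_XsubC u.
have [lt|ge] := ltnP (size p) s.
  by rewrite !nth_default ?size_comp_poly2 // -ltnS (leq_trans lt) ?leqSpred.
have /eqP <- : size p == s by rewrite eqn_leq ps.
rewrite -{1}(size_comp_poly2 p sX) -!lead_coefE lead_coef_comp ?sX //.
by rewrite lead_coefXsubC expr1n mulr1.
Qed.

(** The index is (s - 1) + (size q - 1), the largest degree possible in p q. *)
Lemma coef_mul_monic p q s : q \is monic -> (0 < s)%N -> (size p <= s)%N ->
  (p * q)`_(s + size q).-2 = p`_s.-1.
Proof.
move=> mq s0 ps; have q0 : (0 < size q)%N by rewrite size_poly_gt0 monic_neq0.
have [lt|ge] := ltnP (size p) s.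
  rewrite !nth_default //; first by rewrite -ltnS (leq_trans lt) ?leqSpred.
  by apply: leq_trans (size_polyMleq _ _) _; case: s s0 {ps} lt => // s _; lia.
have /eqP <- : size p == s by rewrite eqn_leq ps.
rewrite -size_Mmonic // -?lead_coefE ?lead_coef_Mmonic //.
by rewrite -size_poly_gt0; lia.
Qed.

End QuotientSeries.

(** * Hermite interpolation at the evaluation points *)

Section Hermite.
Variables (F : finFieldType) (s r : nat) (alpha : 'I_r -> F).
Hypothesis alpha_inj : injective alpha.
Implicit Types (p : {poly F}) (c : 'I_r -> nat -> F) (j : 'I_r).

Local Notation A := (Apoly s alpha).

Lemma Apoly_neq0 j : (A j).[alpha j] != 0.
Proof.
rewrite horner_prod; apply/prodf_neq0 => l lj.
by rewrite horner_exp hornerXsubC expf_neq0 // subr_eq0 inj_eq // eq_sym.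
Qed.

Lemma Apoly_monic j : A j \is monic.
Proof. by apply: monic_prod => l _; rewrite monic_exp // monicXsubC. Qed.

Lemma prod_XsubC_expE j :
  \prod_(l < r) ('X - (alpha l)%:P) ^+ s = ('X - (alpha j)%:P) ^+ s * A j.
Proof. by rewrite (bigD1 j). Qed.

Lemma size_prod_XsubC_exp :
  size (\prod_(l < r) ('X - (alpha l)%:P) ^+ s) = (r * s).+1.
Proof.
rewrite prodrXl -[LHS]prednK ?size_poly_gt0 ?expf_neq0 ?monic_neq0 //.
  by rewrite size_exp size_prod_XsubC /= /index_enum -enumT size_enum_ord.
exact: monic_prod_XsubC.
Qed.

Lemma size_Apoly j : (s + size (A j))%N = (r * s).+1.
Proof.
rewrite -size_prod_XsubC_exp (prod_XsubC_expE j).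
rewrite size_Mmonic ?Apoly_monic ?expf_neq0 ?polyXsubC_eq0 //.
by rewrite size_exp_XsubC.
Qed.

Lemma poly_ser_Apoly j l n : l != j -> (n < s)%N ->
  forall q, poly_ser (q * A l) (alpha j) n = 0.
Proof.
move=> lj ltns q.
have /dvd_XsubC_expP -> // : ('X - (alpha j)%:P) ^+ s %| q * A l.
by rewrite dvdp_mull // /Apoly (bigD1 j) ?dvdp_mulIl // eq_sym.
Qed.

(** The pairwise coprime powers (X - alpha_j)^s all divide p, hence so does their product, whose
    degree r s is too large for a nonzero p. *)
Lemma hermite_unique p : (size p <= r * s)%N ->
  (forall j n, (n < s)%N -> quot_ser (A j) p (alpha j) n = 0) -> p = 0.
Proof.
move=> sp H; apply/eqP; apply: contraTT sp => p0.
rewrite -ltnNge -size_prod_XsubC_exp; apply: dvdp_leq => //.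
have dv j : ('X - (alpha j)%:P) ^+ s %| p.
  exact: quot_ser_eq0_dvd (Apoly_neq0 j) (H j).
have co j l : j != l ->
    coprimep (('X - (alpha j)%:P) ^+ s) (('X - (alpha l)%:P) ^+ s).
  move=> jl; rewrite coprimep_expl // coprimep_expr // coprimep_XsubC2 //.
  by rewrite subr_eq0 inj_eq // eq_sym.
(* Absence of repetitions keeps each factor coprime to the product of the later ones. *)
have: uniq (index_enum 'I_r) by apply: index_enum_uniq.
elim: (index_enum _) => [|j e IHe] /=; first by rewrite big_nil dvd1p.
case/andP=> je ue; rewrite big_cons Gauss_dvdp ?dv ?IHe //.
rewrite big_seq; apply: (big_ind (coprimep (('X - (alpha j)%:P) ^+ s))).
- exact: coprimep1.
- by move=> x y cx cy; rewrite coprimepMr cx.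
by move=> l le; apply: co; apply: contraNneq je => ->.
Qed.

Definition local_poly (e : nat -> F) u : {poly F} :=
  (\poly_(i < s) e i) \Po ('X - u%:P).

Lemma size_local_poly e u : (size (local_poly e u) <= s)%N.
Proof. by rewrite size_comp_poly2 ?size_XsubC // size_poly. Qed.

Lemma poly_ser_local e u n : (n < s)%N -> poly_ser (local_poly e u) u n = e n.
Proof.
move=> ltns; rewrite /poly_ser /local_poly -comp_polyA comp_XsubC_addC.
by rewrite comp_polyXr coef_poly ltns.
Qed.

Definition hermite c : {poly F} :=
  \sum_j local_poly (c j) (alpha j) * A j.

Lemma size_hermite c : (size (hermite c) <= r * s)%N.
Proof.
apply: leq_trans (size_sum _ _ _) _; apply/bigmax_leqP => j _.
apply: leq_trans (size_polyMleq _ _) _; rewrite -ltnS -(size_Apoly j).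
have := size_local_poly (c j) (alpha j); have := size_Apoly j.
by case: (size (A j)) => [|m]; lia.
Qed.

(** The summands with l != j vanish to order s at alpha_j, because [A l] contains (X -
    alpha_j)^s. *)
Lemma quot_ser_hermite c j n : (n < s)%N ->
  quot_ser (A j) (hermite c) (alpha j) n = c j n.
Proof.
move=> ltns; rewrite quot_ser_sum (bigD1 j) //= big1 ?addr0 => [|l lj].
  by rewrite quot_ser_id ?Apoly_neq0 // poly_ser_local.
by apply: (@quot_ser_eq0 _ _ _ _ s) => // m ltms; apply: poly_ser_Apoly.
Qed.

Lemma coef_hermite c : (0 < s)%N ->
  (hermite c)`_(r * s).-1 = \sum_j c j s.-1.
Proof.
move=> s0; rewrite coef_sum; apply: eq_bigr => j _.
(* The index becomes [(s + size (A j)).-2], as [coef_mul_monic] requires. *)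
rewrite -[(r * s)%N]/((r * s).+1.-1) -(size_Apoly j).
rewrite coef_mul_monic ?Apoly_monic ?size_local_poly //.
by rewrite coef_comp_XsubC ?size_poly // coef_poly prednK // leqnn.
Qed.

(* The residues of p / \prod_l (x - alpha_l)^s at the alpha_j sum up to minus
   the residue at infinity. *)
Lemma sum_residues p : (0 < s)%N -> (size p <= r * s)%N ->
  \sum_j quot_ser (A j) p (alpha j) s.-1 = p`_(r * s).-1.
Proof.
move=> s0 sp; pose c j := quot_ser (A j) p (alpha j).
suff E : hermite c = p by rewrite -[in RHS]E coef_hermite.
apply/esym/subr0_eq; apply: hermite_unique => [|j n ltns].
  apply: leq_trans (size_polyD _ _) _.
  by rewrite geq_max sp size_polyN size_hermite.
by rewrite quot_serB quot_ser_hermite // subrr.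
Qed.

End Hermite.

(** * The dual code and its Toeplitz form *)

Section DualCode.
Variables (F : finFieldType) (s r : nat) (alpha : 'I_r -> F) (V : 'M[F]_(s, r)).
Hypotheses (s_gt0 : (0 < s)%N) (alpha_inj : injective alpha).
Hypothesis V_neq0 : forall i j, V i j != 0.
Implicit Types f g : {poly F}.

Local Notation A := (Apoly s alpha).

Lemma dual_wordE g i j :
  dual_word alpha V g i j =
  (V i j)^-1 * quot_ser (A j) g (alpha j) (s - i.+1).
Proof. by rewrite mxE rat_hderivE ?Apoly_neq0. Qed.

(** The multipliers cancel and the orders i and s - 1 - i are complementary, so each column
    contributes one Cauchy product coefficient. *)
Lemma mx_dot_dual_word f g :
  mx_dot (hrs_word alpha V f) (dual_word alpha V g) =
  \sum_j quot_ser (A j) (f * g) (alpha j) s.-1.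
Proof.
rewrite /mx_dot exchange_big; apply: eq_bigr => j _.
rewrite quot_serM /ser_mul prednK //; apply: eq_bigr => i _.
have -> : (s.-1 - i = s - i.+1)%N by lia.
by rewrite dual_wordE mxE poly_ser_hderiv mulrACA mulfV ?mul1r.
Qed.

Lemma dual_word_surj (B : 'M[F]_(s, r)) :
  exists2 g : {poly F}, (size g <= r * s)%N & dual_word alpha V g = B.
Proof.
(* Row i prescribes the coefficient of order s - 1 - i. The default 0 is never reached, since s - (n
   + 1) < s. *)
pose c j n := if insub (s - n.+1)%N is Some i then V i j * B i j else 0.
exists (hermite s alpha c); first exact: size_hermite.
apply/matrixP => i j; rewrite dual_wordE quot_ser_hermite ?ltn_subrL //.
rewrite /c subnSK // subKn ?(ltnW (ltn_ord i)) // valK.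
by rewrite mulKf.
Qed.

Lemma mem_HRS k f : (size f <= k)%N -> hrs_word alpha V f \in HRS k alpha V.
Proof. by move=> sf; apply/imsetP; exists (NPoly sf). Qed.

Lemma dual_HRSE k : (0 < r)%N -> (k <= r * s)%N ->
  euclidean_dual (HRS k alpha V) =
  [set dual_word alpha V g | g : {poly_(r * s - k) F}].
Proof.
move=> r_gt0 lek; have rs_gt0 : (0 < r * s)%N by rewrite muln_gt0 r_gt0.
apply/setP=> B; rewrite inE; apply/idP/imsetP => [/forall_inP orth|[g _ ->]].
  have [g sg EB] := dual_word_surj B.
  suff sg' : (size g <= r * s - k)%N by exists (NPoly sg').
  rewrite leqNgt; apply/negP => ltg.
  have g0 : (0 < size g)%N by apply: leq_ltn_trans ltg.
  (* This power moves the leading coefficient of g to degree r s - 1, so the pairing equals that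
     nonzero coefficient. *)
  have sf : (size ('X^(r * s - size g) : {poly F}) <= k)%N.
    by rewrite size_polyXn; move: (size g) sg ltg g0 => m sg ltg g0; lia.
  have := orth _ (mem_HRS sf); rewrite -EB mx_dot_dual_word sum_residues //.
    rewrite coefXnM ifN; last by rewrite -leqNgt -ltnS prednK // ltn_subrL g0.
    have -> : ((r * s).-1 - (r * s - size g) = (size g).-1)%N.
      by move: (size g) sg g0 => m sg g0; lia.
    by rewrite -lead_coefE lead_coef_eq0 -size_poly_leq0 leqNgt g0.
  apply: leq_trans (size_polyMleq _ _) _; rewrite size_polyXn.
  by move: (size g) sg g0 => m sg g0; lia.
(* Conversely f g has degree at most r s - 2, so its coefficient of degree r s - 1 is zero. *)
apply/forall_inP=> _ /imsetP[f _ ->]; rewrite mx_dot_dual_word sum_residues //.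
  rewrite nth_default //; apply: leq_trans (size_polyMleq _ _) _.
  have := size_npoly f; have := size_npoly g; move: lek.
  by move: (size f) (size g) => m n lek' ln lm; lia.
apply: leq_trans (size_polyMleq _ _) _.
have := size_npoly f; have := size_npoly g; move: lek.
by move: (size f) (size g) => m n lek' ln lm; lia.
Qed.

Lemma hrs_gammaE n j :
  hrs_gamma s alpha n j = ser_inv (poly_ser (A j) (alpha j)) n.
Proof. by rewrite /hrs_gamma rat_hderivV ?Apoly_neq0. Qed.

Lemma hrs_gamma0 j : hrs_gamma s alpha 0 j = ((A j).[alpha j])^-1.
Proof. by rewrite hrs_gammaE /ser_inv /= poly_ser_0. Qed.

Lemma hrs_gamma0_neq0 j : hrs_gamma s alpha 0 j != 0.
Proof. by rewrite hrs_gamma0 invr_neq0 ?Apoly_neq0. Qed.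

Lemma toeplitzU_unit j : toeplitzU s alpha j \in unitmx.
Proof.
rewrite unitmxE unitfE -det_tr det_trig; last first.
  by apply/is_trig_mxP => a b ltab; rewrite !mxE leqNgt ltab.
by apply/prodf_neq0 => i _; rewrite !mxE leqnn subnn hrs_gamma0_neq0.
Qed.

(** Row i is the Cauchy product of 1 / A_j and g at order s - 1 - i; the substitution b = a + i
    makes it a row of the Toeplitz product. *)
Lemma col_dual_word g j :
  col j (dual_word alpha V g) =
  diagD V j *m toeplitzU s alpha j *m hderiv_vec s alpha j g.
Proof.
apply/matrixP => i z; rewrite [LHS]mxE dual_wordE -mulmxA mul_diag_mx !mxE.
congr (_ * _); rewrite /quot_ser /ser_mul.
under [RHS]eq_bigr do rewrite !mxE -poly_ser_hderiv.
rewrite (bigID (fun b : 'I_s => i <= b)%N) /= [X in _ = _ + X]big1 ?addr0.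
  pose h b := ser_inv (poly_ser (A j) (alpha j)) (b - i) *
    poly_ser g (alpha j) (s - b.+1).
  transitivity (\sum_(i <= b < s) h b).
    have -> : \sum_(i <= b < s) h b = \sum_(0 <= b < s - i) h (b + i)%N.
      by rewrite -{1}[nat_of_ord i]add0n big_addn.
    rewrite big_mkord subnSK //.
    apply: eq_bigr => a _; rewrite /h addnK; congr (_ * poly_ser _ _ _); lia.
  rewrite big_geq_mkord; apply: eq_bigr => b leib.
  by rewrite (leib : (i <= b)%N) hrs_gammaE.
by move=> b /negbTE ->; rewrite mul0r.
Qed.

End DualCode.

Theorem mainTheorem2 :
  (forall (F : finFieldType) (r s k : nat) (alpha : 'I_r -> F) (V : 'M[F]_(s, r)),
     (1 <= r)%N -> (1 <= s)%N -> (r <= #|F|)%N ->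
     injective alpha -> (forall i j, V i j != 0) -> (k <= r * s)%N ->
     [/\ euclidean_dual (HRS k alpha V)
           = [set dual_word alpha V g | g : {poly_(r * s - k) F}],
         (forall (g : {poly_(r * s - k) F}) (j : 'I_r),
            col j (dual_word alpha V g)
              = diagD V j *m toeplitzU s alpha j *m hderiv_vec s alpha j g)
       & (forall j : 'I_r,
            [/\ hrs_gamma s alpha 0 j = ((Apoly s alpha j).[alpha j])^-1,
                hrs_gamma s alpha 0 j != 0
              & toeplitzU s alpha j \in unitmx])])
  /\
  (exists (F : finFieldType) (r s k : nat) (alpha : 'I_r -> F) (V : 'M[F]_(s, r)),
     [/\ (1 <= r)%N, (1 <= s)%N, (r <= #|F|)%N & (k <= r * s)%N] /\
     [/\ injective alpha, (forall i j, V i j != 0)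
       & forall (beta : 'I_r -> F) (U : 'M[F]_(s, r)),
           injective beta -> (forall i j, U i j != 0) ->
           euclidean_dual (HRS k alpha V) <> HRS (r * s - k) beta U]).
Proof.
split=> [F r s k alpha V r0 s0 _ ainj V0 lek|].
  split; first exact: dual_HRSE.
    by move=> g j; apply: col_dual_word.
  move=> j; split; [exact: hrs_gamma0|exact: hrs_gamma0_neq0|].
  exact: toeplitzU_unit.
(* With a single evaluation point, HRS_1 consists of the multiples of the first
   unit vector, and its dual of those of the second one. *)
exists 'F_2, 1%N, 2%N, 1%N, (fun=> 0), (const_mx 1); split.
  by rewrite card_Fp.
split=> [i j _|i j|beta U _ _ E].
- by rewrite !ord1.
- by rewrite mxE oner_neq0.
pose B : 'M['F_2]_(2, 1) := \matrix_(i, j) (i == ord_max)%:R.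
have nderivn1_const (f : {poly_1 'F_2}) : f^`N(1) = 0.
  apply/polyP => i; rewrite coef_nderivn coef0 nth_default ?mul0rn //.
  by apply: leq_trans (size_npoly f) _.
(* Here r s - k = 1. The last row of any word of HRS_1 is the derivative of a constant, hence zero,
   whereas that of [B] is 1. *)
have: B \in HRS 1 beta U.
  rewrite -E inE; apply/forall_inP => _ /imsetP[f _ ->].
  rewrite /mx_dot !big_ord_recl !big_ord0 !mxE /= mulr0 !addr0 add0r.
  by rewrite nderivn1_const horner0 mulr0 mul0r.
case/imsetP=> f _ /matrixP/(_ ord_max ord0).
by rewrite !mxE /= nderivn1_const horner0 mulr0 => /eqP; rewrite oner_eq0.
Qed.
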